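(* Let $e^a{}_\mu$ be a coframe at a point of a four-dimensional manifold, $g_{\mu\nu}=\eta_{ab}e^a{}_\mu e^b{}_\nu$ with $\eta=\operatorname{diag}(-1,1,1,1)$, $|e|=|\det(e^a{}_\mu)|$, and let $\kappa^2>0$ be a constant. On the $24$-dimensional fiber of torsion tensors $T^\rho{}_{\mu\nu}=-T^\rho{}_{\nu\mu}$, the MTEGR momentum (Legendre) map $$P_a{}^{\mu\nu}=\frac{\partial(|e|\mathcal L)}{\partial T^a{}_{\mu\nu}}=-\frac{2|e|}{\kappa^2}\,e_a{}^\rho S_\rho{}^{\mu\nu},\qquad S_\rho{}^{\mu\nu}=-K^{\mu\nu}{}_\rho+T^\mu\delta^\nu_\rho-T^\nu\delta^\mu_\rho,$$ is a bijection onto the tensors $P_a{}^{\mu\nu}$ antisymmetric in $\mu\nu$. With $P^{\rho\mu\nu}:=\eta^{ab}e_b{}^\rho P_a{}^{\mu\nu}$ and $\widetilde P^\mu:=e^a{}_\nu P_a{}^{\mu\nu}$, its inverse is $$T_{\rho\mu\nu}=\frac{\kappa^2}{2|e|}\Bigl(P_{\mu\rho\nu}-P_{\nu\rho\mu}+\tfrac12\,g_{\rho\mu}\widetilde P_\nu-\tfrac12\,g_{\rho\nu}\widetilde P_\mu\Bigr),$$ and the Hamiltonian density $|e|\mathcal H_{\rm MTEGR}=T^a{}_{\mu\nu}P_a{}^{\mu\nu}-|e|\mathcal L$, expressed in the momenta, is $$|e|\mathcal H_{\rm MTEGR}=-\frac{\kappa^2}{2|e|}\Bigl(P^{\rho\mu\nu}P_{\mu\nu\rho}+\tfrac12\,\widetilde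 P^\mu\widetilde P_\mu\Bigr).$$
   Context: MTEGR is the metric teleparallel equivalent of general relativity. $e_a{}^\mu$ is the inverse of $e^a{}_\mu$; $T^a{}_{\mu\nu}=e^a{}_\rho T^\rho{}_{\mu\nu}$; coordinate indices are moved with $g$. The torsion trace is $T_\mu=T^\rho{}_{\mu\rho}$. The contortion is $K^\rho{}_{\mu\nu}=T_{(\mu}{}^\rho{}_{\nu)}-\tfrac12T^\rho{}_{\mu\nu}$ with $A_{(\mu\nu)}=\tfrac12(A_{\mu\nu}+A_{\nu\mu})$, i.e. $K_{\rho\mu\nu}=\tfrac12(T_{\mu\rho\nu}+T_{\nu\rho\mu}-T_{\rho\mu\nu})$. The bulk MTEGR Lagrangian density is $$|e|\mathcal L=-\frac{2}{\kappa^2}|e|\,\mathbb T=-\frac1{\kappa^2}|e|\,T^\rho{}_{\mu\nu}S_\rho{}^{\mu\nu},\qquad \mathbb T=-\tfrac14T_{\rho\mu\nu}T^{\rho\mu\nu}+\tfrac12T_{\rho\mu\nu}T^{\mu\nu\rho}+T_\mu T^\mu .$$ The derivative with respect to $T^a{}_{\mu\nu}$ is antisymmetric in $\mu\nu$ and normalized by $\delta(|e|\mathcal L)=P_a{}^{\mu\nu}\,\delta T^a{}_{\mu\nu}$ with unrestricted summation over $\mu,\nu$ (at fixed coframe). In $P^{\rho\mu\nu}$ the first slot is the one obtained from the frame index, as in its definition. *)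

(* Defs.v *)
From mathcomp Require Import all_boot all_order all_algebra.
From mathcomp Require Import all_classical all_reals all_analysis.
Import Order.TTheory GRing.Theory Num.Theory numFieldNormedType.Exports.

Set Implicit Arguments.
Unset Strict Implicit.
Unset Printing Implicit Defensive.

Local Open Scope ring_scope.
Local Open Scope classical_set_scope.

(* A three-index object is the array of its components. The height of each
   index (and whether the first one is a frame or a coordinate index) is fixed
   definition by definition. *)
Definition tensor (R : realType) : Type := 'I_4 -> 'I_4 -> 'I_4 -> R.

Definition antisym (R : realType) : set (tensor R) :=
  [set T : tensor R | forall l mu nu, T l mu nu = - T l nu mu].

(* The same arrays as points of a normed space, where the library can
   differentiate: entry (l, mu, nu) sits in row l, column
   mxvec_index mu nu. *)
Definition flat (R : realType) (T : tensor R) : 'M[R]_(4, 4 * 4) :=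
  \matrix_(l, k) mxvec (\matrix_(mu, nu) T l mu nu) 0 k.

Definition unflat (R : realType) (X : 'M[R]_(4, 4 * 4)) : tensor R :=
  fun l mu nu => vec_mx (row l X) mu nu.

(* A matrix acting on one slot of a tensor; with g or its inverse this lowers
   or raises the corresponding index. *)
Definition act1 (R : realType) (M : 'M[R]_4) (T : tensor R) : tensor R :=
  fun l mu nu => \sum_s M l s * T s mu nu.
Definition act2 (R : realType) (M : 'M[R]_4) (T : tensor R) : tensor R :=
  fun l mu nu => \sum_s M mu s * T l s nu.
Definition act3 (R : realType) (M : 'M[R]_4) (T : tensor R) : tensor R :=
  fun l mu nu => \sum_s M nu s * T l mu s.
Definition actv (R : realType) (M : 'M[R]_4) (v : 'I_4 -> R) : 'I_4 -> R :=
  fun mu => \sum_s M mu s * v s.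

(* e a mu is e^a_mu, so that the inverse frame e_a^mu is invmx e mu a. *)
Definition eta (R : realType) : 'M[R]_4 :=
  diag_mx (\row_(i < 4) if i == 0 then -1 else 1).

Definition metric (R : realType) (e : 'M[R]_4) : 'M[R]_4 :=
  \matrix_(mu, nu) \sum_a \sum_b eta R a b * e a mu * e b nu.

Definition imetric (R : realType) (e : 'M[R]_4) : 'M[R]_4 :=
  invmx (metric e).

Definition vol (R : realType) (e : 'M[R]_4) : R := `|\det e|.

(* Below, T is always the mixed torsion T^rho_{mu nu}, and F the torsion
   T^a_{mu nu} with a frame index in the first slot. *)
Definition to_frame (R : realType) (e : 'M[R]_4) (T : tensor R) : tensor R :=
  act1 e T.

Definition of_frame (R : realType) (e : 'M[R]_4) (F : tensor R) : tensor R :=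
  act1 (invmx e) F.

(* T_{rho mu nu} *)
Definition torsion_low (R : realType) (e : 'M[R]_4) (T : tensor R) :
  tensor R := act1 (metric e) T.

(* T^{rho mu nu} *)
Definition torsion_up (R : realType) (e : 'M[R]_4) (T : tensor R) :
  tensor R := act2 (imetric e) (act3 (imetric e) T).

(* T_mu = T^rho_{mu rho} *)
Definition torsion_trace (R : realType) (T : tensor R) : 'I_4 -> R :=
  fun mu => \sum_rho T rho mu rho.

(* T^mu *)
Definition torsion_trace_up (R : realType) (e : 'M[R]_4) (T : tensor R) :
  'I_4 -> R := actv (imetric e) (torsion_trace T).

(* K_{rho mu nu} *)
Definition contortion_low (R : realType) (e : 'M[R]_4) (T : tensor R) :
  tensor R :=
  fun rho mu nu =>
    2^-1 * (torsion_low e T mu rho nu + torsion_low e T nu rho mu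
            - torsion_low e T rho mu nu).

(* S_rho^{mu nu}: arguments in the order rho, mu, nu; the first term is
   K^{mu nu}_rho. *)
Definition superpotential (R : realType) (e : 'M[R]_4) (T : tensor R) :
  tensor R :=
  fun rho mu nu =>
    - act1 (imetric e) (act2 (imetric e) (contortion_low e T)) mu nu rho
    + torsion_trace_up e T mu * (nu == rho)%:R
    - torsion_trace_up e T nu * (mu == rho)%:R.

Definition torsion_scalar (R : realType) (e : 'M[R]_4) (T : tensor R) : R :=
  - 4^-1 * (\sum_rho \sum_mu \sum_nu
              torsion_low e T rho mu nu * torsion_up e T rho mu nu)
  + 2^-1 * (\sum_rho \sum_mu \sum_nu
              torsion_low e T rho mu nu * torsion_up e T mu nu rho)
  + \sum_mu torsion_trace T mu * torsion_trace_up e T mu.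

(* |e| L *)
Definition lagrangian (R : realType) (e : 'M[R]_4) (kappa : R)
  (T : tensor R) : R :=
  - (2 / kappa ^+ 2) * vol e * torsion_scalar e T.

(* |e| L at fixed coframe as a function of T^a_{mu nu}. The polynomial formula
   makes sense on all arrays; is_momentum only sees its values on
   antisymmetric ones, since both the base point and the variations are
   antisymmetric there. *)
Definition lagrangian_frame (R : realType) (e : 'M[R]_4) (kappa : R)
  (X : 'M[R]_(4, 4 * 4)) : R^o :=
  lagrangian e kappa (of_frame e (unflat X)).

(* P a mu nu is P_a^{mu nu}: the derivative of |e| L with respect to
   T^a_{mu nu}, antisymmetric in mu, nu and normalized by
   delta (|e| L) = P_a^{mu nu} delta T^a_{mu nu}. *)
Definition is_momentum (R : realType) (e : 'M[R]_4) (kappa : R)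
  (T P : tensor R) : Prop :=
  let F := flat (to_frame e T) in
  [/\ antisym P,
      differentiable (lagrangian_frame e kappa) F
    & forall dF : tensor R, antisym dF ->
        'd (lagrangian_frame e kappa) F (flat dF) =
        \sum_a \sum_mu \sum_nu P a mu nu * dF a mu nu].

Definition momentum (R : realType) (e : 'M[R]_4) (kappa : R)
  (T : tensor R) : tensor R :=
  xget (fun _ _ _ => 0) [set P : tensor R | is_momentum e kappa T P].

(* P^{rho mu nu} = eta^{ab} e_b^rho P_a^{mu nu} *)
Definition momentum_up (R : realType) (e : 'M[R]_4) (P : tensor R) :
  tensor R :=
  fun rho mu nu =>
    \sum_a \sum_b invmx (eta R) a b * invmx e rho b * P a mu nu.

(* P_{rho mu nu} *)
Definition momentum_low (R : realType) (e : 'M[R]_4) (P : tensor R) :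
  tensor R :=
  act1 (metric e) (act2 (metric e) (act3 (metric e) (momentum_up e P))).

(* Ptilde^mu = e^a_nu P_a^{mu nu} *)
Definition momentum_trace_up (R : realType) (e : 'M[R]_4) (P : tensor R) :
  'I_4 -> R := fun mu => \sum_a \sum_nu e a nu * P a mu nu.

(* Ptilde_mu *)
Definition momentum_trace (R : realType) (e : 'M[R]_4) (P : tensor R) :
  'I_4 -> R := actv (metric e) (momentum_trace_up e P).

(* |e| H = T^a_{mu nu} P_a^{mu nu} - |e| L *)
Definition hamiltonian (R : realType) (e : 'M[R]_4) (kappa : R)
  (T P : tensor R) : R :=
  \sum_a \sum_mu \sum_nu to_frame e T a mu nu * P a mu nu
  - lagrangian e kappa T.

(* Main.v *)
(* Lower every index with the metric. As a function of T_{rho mu nu} the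
   momentum is a multiple of
     S_{rho mu nu} = (T_{mu nu rho} - T_{nu mu rho} - T_{rho mu nu}) / 2
                     + T_mu g_{nu rho} - T_nu g_{mu rho},
   because |e| L is the diagonal of a bilinear form whose symmetrization is the
   pairing with S, up to a constant. Contracting with g gives
   S^rho_{mu rho} = 2 T_mu, so S_{mu rho nu} - S_{nu rho mu} is -T_{rho mu nu}
   plus trace terms, and this inverts the map. Since |e| L is homogeneous of
   degree 2, T . P = 2 |e| L, so |e| H = |e| L = (T . P) / 2, into which the
   inverse is substituted. *)

Require Import Defs.
From mathcomp Require Import all_boot all_order all_algebra.
From mathcomp Require Import all_classical all_reals all_analysis.
From mathcomp Require Import ring lra.
Import Order.TTheory GRing.Theory Num.Theory numFieldNormedType.Exports.

Local Open Scope ring_scope.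
Local Open Scope classical_set_scope.

(** * Differentiating quadratic functions of a matrix *)

Lemma is_diff_bigsum (R : realType) (V : normedModType R) (I : Type)
  (r : seq I) (f df : I -> V -> R^o) (x : V) :
  (forall i, is_diff x (f i) (df i)) ->
  is_diff x (fun y => \sum_(i <- r) f i y) (fun y => \sum_(i <- r) df i y).
Proof.
move=> hf; elim: r => [|i r IHr].
  have -> : (fun y => \sum_(i <- [::]) f i y) = cst (0 : R^o).
    by apply/funext => y; rewrite big_nil.
  have -> : (fun y => \sum_(i <- [::]) df i y) = 0 :> (V -> R^o).
    by apply/funext => y; rewrite big_nil.
  exact: is_diff_cst.
have -> : (fun y => \sum_(j <- i :: r) f j y) =
          f i + (fun y => \sum_(j <- r) f j y).
  by apply/funext => y; rewrite big_cons.
have -> : (fun y => \sum_(j <- i :: r) df j y) =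
          df i + (fun y => \sum_(j <- r) df j y).
  by apply/funext => y; rewrite big_cons.
exact: is_diffD.
Qed.

Lemma is_diff_coord (R : realType) (m n : nat) (X : 'M[R]_(m, n)) i j :
  is_diff X (fun Y : 'M[R]_(m, n) => Y i j : R^o) (fun Y => Y i j).
Proof.
(* The coordinate is packaged as a linear map, so that continuity yields differentiability and the
   differential is the map itself. The [@] keeps its body visible. *)
have @f : {linear 'M[R]_(m, n) -> R^o}.
  by exists (fun N : 'M[R]_(_, _) => N i j : R^o); do 2![eexists];
     do ?[constructor]; rewrite ?mxE// => ? *; rewrite ?mxE//; move=> ?;
     rewrite !mxE.
have fc : continuous f by exact: coord_continuous.
apply: DiffDef; first exact: (linear_differentiable X fc).
by rewrite (diff_lin X fc).
Qed.

Lemma linear_coordE (R : realType) (m n : nat) (f : 'M[R]_(m, n) -> R) :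
  (forall a X Y, f (a *: X + Y) = a * f X + f Y) ->
  forall X, f X = \sum_i \sum_j X i j * f (delta_mx i j).
Proof.
move=> fl X.
have f0 : f 0 = 0.
  have := fl (-1) 0 0; rewrite scaler0 addr0 mulN1r addNr.
  by move=> ->.
have fsum (I : finType) (F : I -> 'M[R]_(m, n)) :
    f (\sum_i F i) = \sum_i f (F i).
  apply: (big_morph f) => // Y Z.
  by rewrite -[Y]scale1r fl scale1r mul1r.
rewrite {1}[X]matrix_sum_delta fsum; apply: eq_bigr => i _.
rewrite fsum; apply: eq_bigr => j _.
by rewrite -[_ *: _]addr0 fl f0 addr0.
Qed.

(** Continuity comes from finite dimension: in elementary matrices [f] is a finite combination of
    coordinates, each of which is its own differential. *)
Lemma is_diff_linear_mx (R : realType) (m n : nat)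
  (f : 'M[R]_(m, n) -> R^o) (X : 'M[R]_(m, n)) :
  (forall a X Y, f (a *: X + Y) = a * f X + f Y) -> is_diff X f f.
Proof.
move=> fl.
have -> : f = fun Y => \sum_i \sum_j Y i j * f (delta_mx i j) :> R^o.
  by apply/funext => Y; exact: (@linear_coordE R m n f fl).
apply: is_diff_bigsum => i; apply: is_diff_bigsum => j.
have -> : (fun Y : 'M[R]_(m, n) => Y i j * f (delta_mx i j)) =
          f (delta_mx i j) *: (fun Y => Y i j : R^o).
  by apply/funext => Y; rewrite mulrC.
by apply: is_diffZ; exact: is_diff_coord.
Qed.

(** Only the first argument of [B] is expanded in coordinates. The diagonal becomes a sum of
    products of a coordinate and a linear function, and the Leibniz rule applies. [B] may be
    asymmetric, hence the two terms in the derivative. *)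
Lemma is_diff_quadratic_mx (R : realType) (m n : nat)
  (B : 'M[R]_(m, n) -> 'M[R]_(m, n) -> R) (X : 'M[R]_(m, n)) :
  (forall a X Y Z, B (a *: X + Y) Z = a * B X Z + B Y Z) ->
  (forall a X Y Z, B Z (a *: X + Y) = a * B Z X + B Z Y) ->
  is_diff X (fun Y => B Y Y : R^o) (fun Y => B X Y + B Y X).
Proof.
move=> Bl Br.
have BE Y Z : B Y Z = \sum_i \sum_j Y i j * B (delta_mx i j) Z.
  exact: (@linear_coordE R m n (B ^~ Z) (fun a U V => Bl a U V Z)).
have -> : (fun Y => B Y Y : R^o) =
    fun Y => \sum_i \sum_j Y i j * B (delta_mx i j) Y.
  by apply/funext => Y; exact: BE.
have -> : (fun Y => B X Y + B Y X : R^o) = fun Y => \sum_i \sum_j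
    (X i j * B (delta_mx i j) Y + B (delta_mx i j) X * Y i j).
  apply/funext => Y; rewrite (BE X Y) (BE Y X) -big_split /=.
  apply: eq_bigr => i _; rewrite -big_split /=.
  by apply: eq_bigr => j _; rewrite [_ * Y i j]mulrC.
apply: is_diff_bigsum => i; apply: is_diff_bigsum => j.
have h1 := @is_diff_coord R m n X i j.
have h2 := @is_diff_linear_mx R m n (B (delta_mx i j)) X
  (fun a U V => Br a U V (delta_mx i j)).
exact: (@is_diffM R _ (fun Y : 'M[R]_(m, n) => Y i j)
  (B (delta_mx i j)) _ _ X h1 h2).
Qed.

(** * The dimension of the fiber *)

Lemma unflatE (R : realType) (X : 'M[R]_(4, 4 * 4)) l mu nu :
  unflat X l mu nu = X l (mxvec_index mu nu).
Proof. by rewrite /unflat !mxE. Qed.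

Lemma flatK (R : realType) : cancel (@flat R) (@unflat R).
Proof.
move=> T; apply/funext => l; apply/funext => mu; apply/funext => nu.
by rewrite unflatE mxE mxvecE mxE.
Qed.

Lemma unflatK (R : realType) : cancel (@unflat R) (@flat R).
Proof.
move=> X; apply/matrixP => l k; rewrite mxE.
by case/mxvec_indexP: k => mu nu; rewrite mxvecE mxE unflatE.
Qed.

(** With [pair_snd], enumerates the six pairs i < j that label the independent entries of an
    antisymmetric 4 by 4 matrix. *)
Definition pair_fst (k : 'I_6) : 'I_4 :=
  inord (nth 0%N [:: 0; 0; 0; 1; 1; 2]%N k).
Definition pair_snd (k : 'I_6) : 'I_4 :=
  inord (nth 0%N [:: 1; 2; 3; 2; 3; 3]%N k).

Definition skew_basis (R : realType) : 'M[R]_(6, 4 * 4) :=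
  \matrix_(k < 6) mxvec (delta_mx (pair_fst k) (pair_snd k)
                        - delta_mx (pair_snd k) (pair_fst k)).

(** Right multiplication by it reads off the entries at positions i < j; on antisymmetric arrays
    this is inverse to right multiplication by [skew_basis]. *)
Definition skew_coord (R : realType) : 'M[R]_(4 * 4, 6) :=
  \matrix_(i < 4 * 4, k < 6) (i == mxvec_index (pair_fst k) (pair_snd k))%:R.

Lemma mul_skew_coord (R : realType) (X : 'M[R]_(4, 4 * 4)) l k :
  (X *m skew_coord R) l k = unflat X l (pair_fst k) (pair_snd k).
Proof.
rewrite mxE unflatE (bigD1 (mxvec_index (pair_fst k) (pair_snd k))) //=.
rewrite mxE eqxx mulr1 big1 ?addr0 // => i /negPf ni.
by rewrite mxE ni mulr0.
Qed.

Lemma unflat_mul_skew_basis (R : realType) (Y : 'M[R]_(4, 6)) l mu nu :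
  unflat (Y *m skew_basis R) l mu nu =
  \sum_k Y l k * (((mu == pair_fst k) && (nu == pair_snd k))%:R
                  - ((mu == pair_snd k) && (nu == pair_fst k))%:R).
Proof.
rewrite unflatE mxE; apply: eq_bigr => k _.
by rewrite !mxE mxvecE !mxE.
Qed.

Lemma antisym_skew_basis (R : realType) (Y : 'M[R]_(4, 6)) :
  antisym (unflat (Y *m skew_basis R)).
Proof.
move=> l mu nu; rewrite !unflat_mul_skew_basis -sumrN.
apply: eq_bigr => k _; rewrite -mulrN opprB.
by rewrite [(mu == _) && _]andbC [(mu == pair_snd k) && _]andbC.
Qed.

(** Case analysis producing indices in the form [inord k], the form in which [pair_fst] and
    [pair_snd] compute. *)
Lemma forall_ord4 (P : 'I_4 -> Prop) :
  P (inord 0) -> P (inord 1) -> P (inord 2) -> P (inord 3) -> forall i, P i.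
Proof.
move=> P0 P1 P2 P3 [m lm]; have -> : Ordinal lm = inord m.
  by apply/val_inj; rewrite /= inordK.
by move: lm; case: m => [|[|[|[|]]]].
Qed.

Lemma skew_basisK (R : realType) (X : 'M[R]_(4, 4 * 4)) :
  antisym (unflat X) -> X *m skew_coord R *m skew_basis R = X.
Proof.
move=> aX; apply: (can_inj (@unflatK R)).
apply/funext => l; apply/funext => mu; apply/funext => nu.
rewrite unflat_mul_skew_basis.
under eq_bigr => k _ do rewrite mul_skew_coord.
have a0 m : unflat X l m m = 0 by have := aX l m m; lra.
rewrite !big_ord_recl big_ord0 /pair_fst /pair_snd /=.
(* Sixteen cases: diagonal entries vanish, and entries below the diagonal are rewritten through
   those above it, which are the ones [skew_coord] keeps. *)
move: mu nu; apply: forall_ord4; apply: forall_ord4;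
  rewrite -!val_eqE /= !inordK //= ?a0;
  rewrite ?(aX l (inord 1) (inord 0)) ?(aX l (inord 2) (inord 0))
    ?(aX l (inord 3) (inord 0)) ?(aX l (inord 2) (inord 1))
    ?(aX l (inord 3) (inord 1)) ?(aX l (inord 3) (inord 2)); ring.
Qed.

Lemma skew_coordK (R : realType) (Y : 'M[R]_(4, 6)) :
  Y *m skew_basis R *m skew_coord R = Y.
Proof.
apply/matrixP => l k; rewrite mul_skew_coord unflat_mul_skew_basis.
rewrite (bigD1 k) //= !eqxx.
have ne (i : 'I_6) : (pair_fst i == pair_snd i) = false.
  by case: i => [[|[|[|[|[|[|]]]]]] //= ?];
     rewrite /pair_fst /pair_snd -val_eqE /= !inordK.
rewrite ne /= subr0 mulr1 big1 ?addr0 // => i ik.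
(* Distinct labels give distinct ordered pairs, and since every listed pair is increasing, none is
   the reversal of another. So the term of [i] contributes nothing. *)
suff -> : (pair_fst k == pair_fst i) && (pair_snd k == pair_snd i) = false.
  suff -> : (pair_fst k == pair_snd i) && (pair_snd k == pair_fst i) = false.
    by rewrite subrr mulr0.
  by move: i k ik => [[|[|[|[|[|[|]]]]]] //= ?] [[|[|[|[|[|[|]]]]]] //= ?];
    rewrite /pair_fst /pair_snd -!val_eqE /= !inordK.
by move: i k ik => [[|[|[|[|[|[|]]]]]] //= ?] [[|[|[|[|[|[|]]]]]] //= ?];
  rewrite /pair_fst /pair_snd -!val_eqE /= !inordK.
Qed.

(** The fiber is the image of the 4 by 6 matrices under multiplication by [skew_basis]. That map has
    trivial kernel because [skew_coord] undoes it, so the dimension is 4 * 6. *)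
Lemma antisym_vspace (R : realType) :
  exists2 V : {vspace 'M[R]_(4, 4 * 4)},
    (forall X, X \in V <-> antisym (unflat X)) & \dim V = 24%N.
Proof.
pose f := linfun (mulmxr (skew_basis R) : 'M[R]_(4, 6) -> 'M[R]_(4, 4 * 4)).
exists (limg f) => [X|].
  split=> [/memv_imgP[Y _ ->]|aX].
    by rewrite lfunE; exact: antisym_skew_basis.
  rewrite -[X]skew_basisK //.
  have -> : X *m skew_coord R *m skew_basis R = f (X *m skew_coord R).
    by rewrite lfunE.
  by rewrite memv_img // memvf.
rewrite limg_dim_eq ?dimvf ?dim_matrix //.
apply/eqP; rewrite -subv0; apply/subvP => Y; rewrite memv_cap => /andP[_].
rewrite memv_ker lfunE /= => /eqP YS.
by rewrite memv0 -[Y]skew_coordK YS mul0mx.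
Qed.

(** * Index gymnastics *)

(** Three cyclic shifts give back [t] by conversion, and a shift turns an action on one slot into an
    action on the next. Facts proved for one slot are thus transported to the others. *)
Definition cyc {R : realType} (t : tensor R) : tensor R :=
  fun r m n => t m n r.

Definition dot {R : realType} (t u : tensor R) : R :=
  \sum_r \sum_m \sum_n t r m n * u r m n.

Definition raise {R : realType} (h : 'M[R]_4) (t : tensor R) : tensor R :=
  act1 h (act2 h (act3 h t)).

Lemma tensorP {R : realType} (t u : tensor R) :
  (forall r m n, t r m n = u r m n) -> t = u.
Proof.
by move=> tu; apply/funext => r; apply/funext => m; apply/funext => n.
Qed.

Lemma act1_comp {R : realType} (M N : 'M[R]_4) t :
  act1 M (act1 N t) = act1 (M *m N) t.
Proof.
apply: tensorP => r m n; rewrite /act1.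
under eq_bigr do rewrite mulr_sumr.
rewrite exchange_big; apply: eq_bigr => i _.
by rewrite mxE mulr_suml; apply: eq_bigr => j _; rewrite mulrA.
Qed.

Lemma act1_1 {R : realType} (t : tensor R) : act1 1%:M t = t.
Proof.
apply: tensorP => r m n; rewrite /act1 (bigD1 r) //= mxE eqxx mul1r.
by rewrite big1 ?addr0 // => i /negPf ir; rewrite mxE eq_sym ir mul0r.
Qed.

Lemma cyc_act1 {R : realType} (M : 'M[R]_4) t : cyc (act1 M t) = act2 M (cyc t).
Proof. by []. Qed.

Lemma cyc_act2 {R : realType} (M : 'M[R]_4) t : cyc (act2 M t) = act3 M (cyc t).
Proof. by []. Qed.

Lemma cyc_act3 {R : realType} (M : 'M[R]_4) t : cyc (act3 M t) = act1 M (cyc t).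
Proof. by []. Qed.

Lemma act2_comp {R : realType} (M N : 'M[R]_4) t :
  act2 M (act2 N t) = act2 (M *m N) t.
Proof.
have -> : t = cyc (cyc (cyc t)) by [].
by rewrite -!cyc_act1 act1_comp.
Qed.

Lemma act2_1 {R : realType} (t : tensor R) : act2 1%:M t = t.
Proof.
have -> : t = cyc (cyc (cyc t)) by [].
by rewrite -!cyc_act1 act1_1.
Qed.

Lemma act3_comp {R : realType} (M N : 'M[R]_4) t :
  act3 M (act3 N t) = act3 (M *m N) t.
Proof.
have -> : t = cyc (cyc (cyc t)) by [].
by rewrite -!cyc_act2 act2_comp.
Qed.

Lemma act3_1 {R : realType} (t : tensor R) : act3 1%:M t = t.
Proof.
have -> : t = cyc (cyc (cyc t)) by [].
by rewrite -!cyc_act2 act2_1.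
Qed.

Lemma act12C {R : realType} (M N : 'M[R]_4) t :
  act1 M (act2 N t) = act2 N (act1 M t).
Proof.
apply: tensorP => r m n; rewrite /act1 /act2.
under eq_bigr do rewrite mulr_sumr.
under [RHS]eq_bigr do rewrite mulr_sumr.
rewrite exchange_big; apply: eq_bigr => i _; apply: eq_bigr => j _.
by rewrite mulrCA.
Qed.

Lemma act23C {R : realType} (M N : 'M[R]_4) t :
  act2 M (act3 N t) = act3 N (act2 M t).
Proof.
have -> : t = cyc (cyc (cyc t)) by [].
by rewrite -!(cyc_act1, cyc_act2) act12C.
Qed.

Lemma act13C {R : realType} (M N : 'M[R]_4) t :
  act1 M (act3 N t) = act3 N (act1 M t).
Proof.
have -> : t = cyc (cyc (cyc t)) by [].
by rewrite -!(cyc_act3, cyc_act2) act23C.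
Qed.

Lemma cyc_raise {R : realType} (h : 'M[R]_4) t :
  cyc (raise h t) = raise h (cyc t).
Proof. by rewrite {2}/raise act12C act13C. Qed.

Lemma dotC {R : realType} (t u : tensor R) : dot t u = dot u t.
Proof.
by apply: eq_bigr => r _; apply: eq_bigr => m _; apply: eq_bigr => n _;
  rewrite mulrC.
Qed.

Lemma dot_cyc {R : realType} (t u : tensor R) : dot (cyc t) (cyc u) = dot t u.
Proof.
rewrite /dot /cyc exchange_big; apply: eq_bigr => m _.
by rewrite exchange_big.
Qed.

Lemma dot_act1 {R : realType} (M : 'M[R]_4) t u :
  dot (act1 M t) u = dot t (act1 M^T u).
Proof.
rewrite /dot /act1.
transitivity (\sum_r \sum_s \sum_m \sum_n M r s * t s m n * u r m n).
  apply: eq_bigr => r _; rewrite [RHS]exchange_big.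
  apply: eq_bigr => m _; rewrite [RHS]exchange_big.
  by apply: eq_bigr => n _; rewrite mulr_suml.
rewrite exchange_big; apply: eq_bigr => s _.
rewrite exchange_big; apply: eq_bigr => m _.
rewrite exchange_big; apply: eq_bigr => n _.
rewrite mulr_sumr; apply: eq_bigr => r _.
by rewrite mxE -mulrA mulrCA.
Qed.

Lemma dot_act2 {R : realType} (M : 'M[R]_4) t u :
  dot (act2 M t) u = dot t (act2 M^T u).
Proof.
rewrite -[t]/(cyc (cyc (cyc t))) -cyc_act1 -[u]/(cyc (cyc (cyc u))) dot_cyc.
by rewrite dot_act1 -dot_cyc cyc_act1.
Qed.

Lemma dot_act3 {R : realType} (M : 'M[R]_4) t u :
  dot (act3 M t) u = dot t (act3 M^T u).
Proof.
rewrite -[t]/(cyc (cyc (cyc t))) -cyc_act2 -[u]/(cyc (cyc (cyc u))) dot_cyc.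
by rewrite dot_act2 -dot_cyc cyc_act2.
Qed.

(** [dot] sums products of components without a metric, so a matrix crosses it as its transpose. A
    symmetric [h] can therefore raise either factor. *)
Lemma dot_raise {R : realType} (h : 'M[R]_4) t u :
  h^T = h -> dot (raise h t) u = dot t (raise h u).
Proof.
move=> hT; rewrite /raise dot_act1 dot_act2 dot_act3 hT.
by rewrite act12C act13C act23C.
Qed.

Lemma dot_lin {R : realType} (a b : R) (t1 t2 u : tensor R) :
  dot (fun r m n => a * t1 r m n + b * t2 r m n) u =
  a * dot t1 u + b * dot t2 u.
Proof.
rewrite /dot !mulr_sumr -big_split; apply: eq_bigr => r _ /=.
rewrite !mulr_sumr -big_split; apply: eq_bigr => m _ /=.
rewrite !mulr_sumr -big_split; apply: eq_bigr => n _ /=.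
by rewrite mulrDl !mulrA.
Qed.

(** [dot t t] is a sum of squares of components, hence definite even though the spacetime metric is
    not. Uniqueness of the momentum rests on this. *)
Lemma dot_self_eq0 {R : realType} (t : tensor R) :
  dot t t = 0 -> forall r m n, t r m n = 0.
Proof.
have q0 r m n : 0 <= t r m n * t r m n by rewrite -expr2 sqr_ge0.
have s0 r m : 0 <= \sum_n t r m n * t r m n by exact: sumr_ge0.
move=> tt0 r m n.
have /(_ r isT) t1 := psumr_eq0P
  (fun r _ => sumr_ge0 _ (fun m _ => s0 r m)) tt0.
have /(_ m isT) t2 := psumr_eq0P (fun m _ => s0 r m) t1.
have /(_ n isT) /eqP := psumr_eq0P
  (fun n _ => q0 r m n) t2.
by rewrite mulf_eq0 orbb => /eqP.
Qed.

(** * Metric contractions, and the superpotential map in lowered indices *)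

Definition contract {R : realType} (h : 'M[R]_4) (X : 'I_4 -> 'I_4 -> R) : R :=
  \sum_r \sum_s h r s * X s r.

Lemma torsion_trace_act1 {R : realType} (h : 'M[R]_4) t m :
  torsion_trace (act1 h t) m = contract h (fun s r => t s m r).
Proof. by []. Qed.

Lemma contract_lin {R : realType} (h : 'M[R]_4) a b X Y :
  contract h (fun s r => a * X s r + b * Y s r) =
  a * contract h X + b * contract h Y.
Proof.
rewrite /contract !mulr_sumr -big_split; apply: eq_bigr => r _ /=.
rewrite !mulr_sumr -big_split; apply: eq_bigr => s _ /=.
by rewrite mulrDr !mulrA ![h r s * _]mulrC.
Qed.

Lemma contract_tr {R : realType} (h : 'M[R]_4) X :
  h^T = h -> contract h (fun s r => X r s) = contract h X.
Proof.
move=> hT; rewrite /contract exchange_big.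
by apply: eq_bigr => r _; apply: eq_bigr => s _; rewrite -{1}hT mxE.
Qed.

Lemma contract_antisym {R : realType} (h : 'M[R]_4) X :
  h^T = h -> (forall s r, X s r = - X r s) -> contract h X = 0.
Proof.
move=> hT aX; have : contract h X = - contract h X; last by move=> ?; lra.
rewrite -{1}contract_tr // /contract -sumrN; apply: eq_bigr => r _.
by rewrite -sumrN; apply: eq_bigr => s _; rewrite aX mulrN.
Qed.

Lemma contract_inv {R : realType} (h g : 'M[R]_4) :
  h *m g = 1%:M -> contract h g = 4.
Proof.
move=> hg; transitivity (\tr (h *m g)); last by rewrite hg mxtrace1.
by apply: eq_bigr => r _; rewrite mxE.
Qed.

Lemma contract_inv_vec {R : realType} (h g : 'M[R]_4) v m :
  h *m g = 1%:M -> contract h (fun s r => v r * g s m) = v m.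
Proof.
move=> hg; transitivity (\sum_r v r * (h *m g) r m).
  apply: eq_bigr => r _; rewrite mxE mulr_sumr.
  by apply: eq_bigr => s _; rewrite mulrCA.
rewrite hg (bigD1 m) //= mxE eqxx mulr1 big1 ?addr0 // => r /negPf rm.
by rewrite mxE rm mulr0.
Qed.

(* S_{rho mu nu} as a function of T_{rho mu nu}, for a metric g with inverse h;
   its inverse is [- sup_low_inv g h]. *)
Definition sup_low {R : realType} (g h : 'M[R]_4) (t : tensor R) : tensor R :=
  fun r m n => 2^-1 * (t m n r - t n m r - t r m n)
    + torsion_trace (act1 h t) m * g n r - torsion_trace (act1 h t) n * g m r.

Definition sup_low_inv {R : realType} (g h : 'M[R]_4) (p : tensor R) :
  tensor R :=
  fun r m n => p m r n - p n r m
    + 2^-1 * (g r m * torsion_trace (act1 h p) n)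
    - 2^-1 * (g r n * torsion_trace (act1 h p) m).

(** The bracket with factor 1/2 contributes -1 times the trace: one term is antisymmetric in the
    contracted pair, and the other two each give minus the trace. The metric terms contribute 4 - 1
    = 3, the 4 being the spacetime dimension. *)
Lemma torsion_trace_sup_low {R : realType} (g h : 'M[R]_4) t m :
  h^T = h -> g^T = g -> h *m g = 1%:M -> antisym t ->
  torsion_trace (act1 h (sup_low g h t)) m = 2 * torsion_trace (act1 h t) m.
Proof.
move=> hT gT hg at_; have gC i j : g i j = g j i by rewrite -{1}gT mxE.
set tau := torsion_trace (act1 h t).
have -> : torsion_trace (act1 h (sup_low g h t)) m =
    contract h (fun s r => 1 * (2^-1 * (t m r s) + 2^-1 *
      (- 1 * t r m s + - 1 * t s m r)) + 1 *
      (tau m * g s r + - 1 * (tau r * g s m))).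
  rewrite torsion_trace_act1; apply: eq_bigr => r _; apply: eq_bigr => s _.
  by rewrite /sup_low -/tau (gC r s) (gC m s); ring.
rewrite !contract_lin contract_inv // contract_inv_vec //.
rewrite (@contract_tr _ h (fun s r => t s m r)) // -torsion_trace_act1 -/tau.
rewrite (@contract_antisym _ h (fun s r => t m r s)) //; first by field.
Qed.

(** The first two terms contribute 1 and the metric terms (1 - 4)/2, which adds up to -1/2. *)
Lemma torsion_trace_sup_low_inv {R : realType} (g h : 'M[R]_4) p m :
  h^T = h -> g^T = g -> h *m g = 1%:M -> antisym p ->
  torsion_trace (act1 h (sup_low_inv g h p)) m =
  - 2^-1 * torsion_trace (act1 h p) m.
Proof.
move=> hT gT hg ap.
set pi := torsion_trace (act1 h p).
have -> : torsion_trace (act1 h (sup_low_inv g h p)) m =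
    contract h (fun s r => 1 * (1 * p m s r + 1 * p r m s) + 2^-1 *
      (1 * (pi r * g s m) + - pi m * g s r)).
  rewrite torsion_trace_act1; apply: eq_bigr => r _; apply: eq_bigr => s _.
  by rewrite /sup_low_inv -/pi (ap r s m); ring.
rewrite !contract_lin contract_inv // contract_inv_vec //.
rewrite (@contract_tr _ h (fun s r => p s m r)) // -torsion_trace_act1 -/pi.
rewrite (@contract_antisym _ h (fun s r => p m s r)) //; first by field.
Qed.

(** The doubled trace meets the factor 1/2 in [sup_low_inv] and cancels the trace terms of
    [sup_low]. Of the remaining terms, antisymmetry leaves only -t. *)
Lemma sup_lowK {R : realType} (g h : 'M[R]_4) t r m n :
  h^T = h -> g^T = g -> h *m g = 1%:M -> antisym t ->
  sup_low_inv g h (sup_low g h t) r m n = - t r m n.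
Proof.
move=> hT gT hg at_; have gC i j : g i j = g j i by rewrite -{1}gT mxE.
rewrite /sup_low_inv !torsion_trace_sup_low // /sup_low.
rewrite (at_ r n m) (at_ n r m) (at_ m r n) (gC n m).
by field.
Qed.

Lemma sup_low_invK {R : realType} (g h : 'M[R]_4) p r m n :
  h^T = h -> g^T = g -> h *m g = 1%:M -> antisym p ->
  sup_low g h (sup_low_inv g h p) r m n = - p r m n.
Proof.
move=> hT gT hg ap; have gC i j : g i j = g j i by rewrite -{1}gT mxE.
rewrite /sup_low !torsion_trace_sup_low_inv // /sup_low_inv.
rewrite (ap r n m) (ap n r m) (ap m r n) (gC n r) (gC m r) (gC n m).
by field.
Qed.

Lemma torsion_trace_scale {R : realType} (h : 'M[R]_4) a t m :
  torsion_trace (act1 h (fun r m n => a * t r m n)) m =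
  a * torsion_trace (act1 h t) m.
Proof.
rewrite /torsion_trace /act1 mulr_sumr; apply: eq_bigr => r _.
by rewrite mulr_sumr; apply: eq_bigr => s _; rewrite mulrCA.
Qed.

Lemma sup_low_scale {R : realType} (g h : 'M[R]_4) a t r m n :
  sup_low g h (fun r m n => a * t r m n) r m n = a * sup_low g h t r m n.
Proof. by rewrite /sup_low !torsion_trace_scale; ring. Qed.

Lemma sup_low_inv_scale {R : realType} (g h : 'M[R]_4) a p r m n :
  sup_low_inv g h (fun r m n => a * p r m n) r m n =
  a * sup_low_inv g h p r m n.
Proof. by rewrite /sup_low_inv !torsion_trace_scale; ring. Qed.

Lemma antisym_sup_low {R : realType} (g h : 'M[R]_4) t :
  g^T = g -> antisym t -> antisym (sup_low g h t).
Proof.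
move=> gT at_ r m n; have gC i j : g i j = g j i by rewrite -{1}gT mxE.
by rewrite /sup_low (at_ r m n) (gC n r); ring.
Qed.

Lemma antisym_sup_low_inv {R : realType} (g h : 'M[R]_4) p :
  antisym (sup_low_inv g h p).
Proof. by move=> r m n; rewrite /sup_low_inv; ring. Qed.

Lemma antisym_scale {R : realType} a (t : tensor R) :
  antisym t -> antisym (fun r m n => a * t r m n).
Proof. by move=> at_ r m n; rewrite at_ mulrN. Qed.

Lemma antisym_act1 {R : realType} (M : 'M[R]_4) t :
  antisym t -> antisym (act1 M t).
Proof.
move=> at_ r m n; rewrite /act1 -sumrN; apply: eq_bigr => s _.
by rewrite at_ mulrN.
Qed.

Lemma antisym_act23 {R : realType} (M : 'M[R]_4) t :
  antisym t -> antisym (act2 M (act3 M t)).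
Proof.
move=> at_ r m n; rewrite {2}act23C /act2 /act3 -sumrN.
apply: eq_bigr => s _; rewrite -mulrN -sumrN; congr (_ * _).
by apply: eq_bigr => w _; rewrite at_ mulrN.
Qed.

(** * The metric of a coframe, and the superpotential through its lowered form *)

Lemma metricE {R : realType} (e : 'M[R]_4) : metric e = e^T *m eta R *m e.
Proof.
apply/matrixP => m n; rewrite [LHS]mxE [RHS]mxE.
rewrite exchange_big; apply: eq_bigr => b _ /=.
rewrite [in RHS]mxE mulr_suml; apply: eq_bigr => a _.
by rewrite [e^T m a]mxE [e a m * _]mulrC.
Qed.

Lemma eta_unit {R : realType} : eta R \in unitmx.
Proof.
rewrite unitmxE det_diag unitfE; apply/prodf_neq0 => i _; rewrite mxE.
by case: ifP => _; rewrite ?oppr_eq0 oner_neq0.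
Qed.

Lemma eta_tr {R : realType} : (eta R)^T = eta R.
Proof. exact: tr_diag_mx. Qed.

Lemma metric_tr {R : realType} (e : 'M[R]_4) : (metric e)^T = metric e.
Proof. by rewrite metricE !trmx_mul trmxK eta_tr mulmxA. Qed.

Lemma metric_unit {R : realType} (e : 'M[R]_4) :
  e \in unitmx -> metric e \in unitmx.
Proof. by move=> he; rewrite metricE !unitmx_mul unitmx_tr he eta_unit. Qed.

Lemma imetric_tr {R : realType} (e : 'M[R]_4) : (imetric e)^T = imetric e.
Proof. by rewrite /imetric trmx_inv metric_tr. Qed.

Lemma mul_imetric {R : realType} (e : 'M[R]_4) :
  e \in unitmx -> imetric e *m metric e = 1%:M.
Proof. by move=> he; rewrite mulVmx // metric_unit. Qed.

Lemma mul_metric {R : realType} (e : 'M[R]_4) :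
  e \in unitmx -> metric e *m imetric e = 1%:M.
Proof. by move=> he; rewrite mulmxV // metric_unit. Qed.

Lemma act23_vec {R : realType} (M N : 'M[R]_4) v X r m n :
  act2 M (act3 N (fun r m n => v m * X n r)) r m n =
  actv M v m * \sum_s N n s * X s r.
Proof.
rewrite /act2 /act3 /actv mulr_suml; apply: eq_bigr => s _.
rewrite -mulrA; congr (_ * _); rewrite mulr_sumr; apply: eq_bigr => w _.
exact: mulrCA.
Qed.

Lemma superpotentialE {R : realType} (e : 'M[R]_4) T :
  e \in unitmx ->
  superpotential e T = act2 (imetric e) (act3 (imetric e)
    (sup_low (metric e) (imetric e) (torsion_low e T))).
Proof.
move=> he; set g := metric e; set h := imetric e.
have hg : h *m g = 1%:M by exact: mul_imetric.
apply: tensorP => r m n.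
have tauE : torsion_trace (act1 h (torsion_low e T)) = torsion_trace T.
  by rewrite /torsion_low act1_comp hg act1_1.
have delta k l : \sum_s h k s * g s l = (k == l)%:R.
  by have /matrixP/(_ k l) := hg; rewrite !mxE.
have -> : act2 h (act3 h (sup_low g h (torsion_low e T))) r m n =
    - act2 h (act3 h (cyc (contortion_low e T))) r m n
    + act2 h (act3 h (fun r m n => torsion_trace T m * g n r)) r m n
    - act2 h (act3 h (fun r n m => torsion_trace T m * g n r)) r m n.
  rewrite /act2 /act3 -!sumrN -!big_split /=; apply: eq_bigr => s _.
  rewrite -!mulrN -!mulrDr; congr (_ * _).
  rewrite -!sumrN -!big_split /=; apply: eq_bigr => w _.
  rewrite -!mulrN -!mulrDr; congr (_ * _).
  by rewrite /sup_low tauE /cyc /contortion_low; ring.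
rewrite act23_vec delta /superpotential; congr (_ + _ - _).
(* The binders in the order [r n m] encode an exchange of the last two slots. As both slots are
   raised by the same matrix, the exchange passes to the arguments. *)
have -> : act2 h (act3 h (fun r n m => torsion_trace T m * g n r)) r m n =
    act2 h (act3 h (fun r m n => torsion_trace T m * g n r)) r n m.
  by rewrite act23C.
by rewrite act23_vec delta.
Qed.

(** * The torsion scalar as the diagonal of a bilinear form *)

Definition torsion_form {R : realType} (e : 'M[R]_4) (T U : tensor R) : R :=
  - 4^-1 * dot (torsion_low e T) (torsion_up e U)
  + 2^-1 * dot (torsion_low e T) (cyc (torsion_up e U))
  + \sum_mu torsion_trace T mu * torsion_trace_up e U mu.

Lemma torsion_scalarE {R : realType} (e : 'M[R]_4) T :
  torsion_scalar e T = torsion_form e T T.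
Proof. by []. Qed.

Lemma act1_lin {R : realType} (M : 'M[R]_4) a t u r m n :
  act1 M (fun r m n => a * t r m n + u r m n) r m n =
  a * act1 M t r m n + act1 M u r m n.
Proof.
rewrite /act1 mulr_sumr -big_split; apply: eq_bigr => s _ /=.
by rewrite mulrDr mulrCA.
Qed.

Lemma torsion_trace_lin {R : realType} a (t u : tensor R) m :
  torsion_trace (fun r m n => a * t r m n + u r m n) m =
  a * torsion_trace t m + torsion_trace u m.
Proof. by rewrite /torsion_trace mulr_sumr -big_split. Qed.

Lemma actv_lin {R : realType} (M : 'M[R]_4) a v w m :
  actv M (fun m => a * v m + w m) m = a * actv M v m + actv M w m.
Proof.
rewrite /actv mulr_sumr -big_split; apply: eq_bigr => s _ /=.
by rewrite mulrDr mulrCA.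
Qed.

Lemma torsion_up_lin {R : realType} (e : 'M[R]_4) a t u :
  torsion_up e (fun r m n => a * t r m n + u r m n) =
  fun r m n => a * torsion_up e t r m n + torsion_up e u r m n.
Proof.
apply: tensorP => r m n; rewrite /torsion_up /act2 /act3.
rewrite mulr_sumr -big_split; apply: eq_bigr => s _ /=.
rewrite [a * _]mulrCA -mulrDr; congr (_ * _).
rewrite mulr_sumr -big_split; apply: eq_bigr => w _ /=.
by rewrite mulrDr mulrCA.
Qed.

Lemma torsion_form_linl {R : realType} (e : 'M[R]_4) a T U V :
  torsion_form e (fun r m n => a * T r m n + U r m n) V =
  a * torsion_form e T V + torsion_form e U V.
Proof.
have lowE : torsion_low e (fun r m n => a * T r m n + U r m n) =
    fun r m n => a * torsion_low e T r m n + 1 * torsion_low e U r m n.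
  by apply: tensorP => r m n; rewrite /torsion_low act1_lin mul1r.
have trE : \sum_mu torsion_trace (fun r m n => a * T r m n + U r m n) mu
      * torsion_trace_up e V mu =
    a * (\sum_mu torsion_trace T mu * torsion_trace_up e V mu) +
    \sum_mu torsion_trace U mu * torsion_trace_up e V mu.
  rewrite mulr_sumr -big_split; apply: eq_bigr => m _ /=.
  by rewrite torsion_trace_lin mulrDl mulrA.
by rewrite /torsion_form lowE !dot_lin trE; ring.
Qed.

Lemma torsion_form_linr {R : realType} (e : 'M[R]_4) a T U V :
  torsion_form e V (fun r m n => a * T r m n + U r m n) =
  a * torsion_form e V T + torsion_form e V U.
Proof.
have trE : \sum_mu torsion_trace V mu
      * torsion_trace_up e (fun r m n => a * T r m n + U r m n) mu =
    a * (\sum_mu torsion_trace V mu * torsion_trace_up e T mu) +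
    \sum_mu torsion_trace V mu * torsion_trace_up e U mu.
  rewrite mulr_sumr -big_split; apply: eq_bigr => m _ /=.
  rewrite /torsion_trace_up [X in actv _ X](_ : _ = fun m =>
    a * torsion_trace T m + torsion_trace U m).
    by rewrite actv_lin mulrDr mulrCA.
  by apply/funext => k; rewrite torsion_trace_lin.
rewrite /torsion_form trE torsion_up_lin ![dot (torsion_low e V) _]dotC.
have cycE t u : cyc (fun r m n => a * t r m n + u r m n) =
    fun r m n => a * cyc t r m n + 1 * cyc u r m n.
  by apply: tensorP => r m n; rewrite mul1r.
(* The explicit coefficient 1 gives the sum the shape expected by [dot_lin]. *)
have oneE (t u : tensor R) : (fun r m n => a * t r m n + u r m n) =
    fun r m n => a * t r m n + 1 * u r m n.
  by apply: tensorP => r m n; rewrite mul1r.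
by rewrite cycE oneE !dot_lin; ring.
Qed.

Lemma dot_trace {R : realType} (v : 'I_4 -> R) (U : tensor R) :
  dot (fun r m n => v m * (n == r)%:R) U = \sum_m v m * torsion_trace U m.
Proof.
rewrite /dot exchange_big; apply: eq_bigr => m _.
rewrite mulr_sumr; apply: eq_bigr => r _.
rewrite (bigD1 r) //= eqxx mulr1 big1 ?addr0 // => n /negPf nr.
by rewrite nr mulr0 mul0r.
Qed.

Lemma dot_antisym {R : realType} (t U : tensor R) :
  antisym U -> dot (fun r m n => t r n m) U = - dot t U.
Proof.
move=> aU; rewrite /dot -sumrN; apply: eq_bigr => r _.
rewrite exchange_big -sumrN; apply: eq_bigr => m _.
by rewrite -sumrN; apply: eq_bigr => n _; rewrite aU mulrN.
Qed.

Lemma actv_sym {R : realType} (M : 'M[R]_4) v w :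
  M^T = M -> \sum_m v m * actv M w m = \sum_m w m * actv M v m.
Proof.
move=> MT; rewrite /actv; under eq_bigr do rewrite mulr_sumr.
rewrite exchange_big; apply: eq_bigr => m _; rewrite mulr_sumr.
by apply: eq_bigr => n _; rewrite -{1}MT mxE; ring.
Qed.

(** This identifies S as the gradient of the torsion scalar. With t and u the lowered torsions, both
    sides reduce to pairings of t, [cyc t] and [cyc (cyc t)] with u raised, with coefficients -1/2,
    1/2 and 1/2, plus twice the product of the traces. *)
Lemma torsion_form_sym {R : realType} (e : 'M[R]_4) T U :
  e \in unitmx -> antisym T -> antisym U ->
  torsion_form e T U + torsion_form e U T = dot (superpotential e T) U.
Proof.
move=> he aT aU; pose h := imetric e.
have hT : h^T = h by exact: imetric_tr.
have lowK V : act1 h (torsion_low e V) = V.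
  by rewrite /torsion_low act1_comp mul_imetric // act1_1.
set t := torsion_low e T; set u := torsion_low e U.
have at_ : antisym t by exact: antisym_act1.
have upE V : torsion_up e V = raise h (torsion_low e V).
  by rewrite /raise act12C act13C lowK.
have -> : superpotential e T = fun r m n =>
    - 1 * cyc (act1 h (act2 h (contortion_low e T))) r m n
    + 1 * (fun r m n => 1 * (torsion_trace_up e T m * (n == r)%:R)
           + - 1 * (torsion_trace_up e T n * (m == r)%:R)) r m n.
  by apply: tensorP => r m n; rewrite /superpotential /cyc; ring.
rewrite !dot_lin dot_trace.
rewrite (dot_antisym (fun r m n => torsion_trace_up e T m * (n == r)%:R)) //.
rewrite dot_trace -[in RHS](lowK U) -/u dotC dot_act1 hT.
rewrite -[act1 h (cyc _)]/(raise h (cyc (contortion_low e T))).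
(* Antisymmetry in the last two slots makes every term of the contortion a cyclic shift of [t], up
   to sign. *)
have -> : cyc (contortion_low e T) = fun r m n =>
    - 2^-1 * cyc (cyc t) r m n + 1 * (fun r m n =>
      2^-1 * t r m n + - 2^-1 * cyc t r m n) r m n.
  apply: tensorP => r m n; rewrite /cyc /contortion_low -/t.
  by rewrite (at_ n m r); ring.
rewrite dotC dot_raise // !dot_lin.
rewrite /torsion_form !upE -/t -/u.
rewrite /torsion_trace_up (actv_sym _ (torsion_trace T)) ?imetric_tr //.
under [in RHS]eq_bigr do rewrite mulrC.
(* Both factors are shifted twice more, so that the shifts on the right-hand factor add up to three
   and disappear. *)
have -> : dot t (cyc (raise h u)) = dot (cyc (cyc t)) (raise h u).
  by rewrite -2!dot_cyc.
have -> : dot u (raise h t) = dot t (raise h u) by rewrite -dot_raise // dotC.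
have -> : dot u (cyc (raise h t)) = dot (cyc t) (raise h u).
  by rewrite cyc_raise -dot_raise // dotC.
by rewrite [act1 h u]lowK; field.
Qed.

(** * The Legendre map *)

Lemma vol_neq0 {R : realType} (e : 'M[R]_4) : e \in unitmx -> vol e != 0.
Proof. by move=> he; rewrite normr_eq0 -unitfE -unitmxE. Qed.

Lemma sqr_gt0_neq0 {R : realType} (x : R) : 0 < x ^+ 2 -> x != 0.
Proof. by rewrite lt0r sqrf_eq0 => /andP[]. Qed.

(** * Moving the indices of the momentum *)

Lemma momentum_upE {R : realType} (e : 'M[R]_4) P :
  momentum_up e P = act1 (invmx e *m invmx (eta R)) P.
Proof.
apply: tensorP => r m n; rewrite /momentum_up /act1.
apply: eq_bigr => a _; rewrite mxE mulr_suml; apply: eq_bigr => b _.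
by rewrite -{1}eta_tr -trmx_inv mxE; ring.
Qed.

(** In the first slot the metric [e^T *m eta *m e] meets the inverses of [e] and [eta], and only
    [e^T] survives: the lowered first index is the frame index contracted with the coframe. *)
Lemma momentum_lowE {R : realType} (e : 'M[R]_4) P :
  e \in unitmx ->
  momentum_low e P = act1 e^T (act2 (metric e) (act3 (metric e) P)).
Proof.
move=> he; rewrite /momentum_low momentum_upE -act13C -act12C act1_comp.
by rewrite {1}metricE mulmxA mulmxK // -!mulmxA mulmxV ?eta_unit // mulmx1.
Qed.

Lemma momentum_lowK {R : realType} (e : 'M[R]_4) P : e \in unitmx ->
  act1 (invmx e)^T (act2 (imetric e) (act3 (imetric e) (momentum_low e P))) = P.
Proof.
move=> he; rewrite momentum_lowE // -act13C -act12C -act23C.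
rewrite act3_comp act2_comp act1_comp mul_imetric // act3_1 act2_1.
by rewrite -trmx_mul mulmxV // trmx1 act1_1.
Qed.

Lemma raise_momentum_low {R : realType} (e : 'M[R]_4) P : e \in unitmx ->
  raise (imetric e) (momentum_low e P) = momentum_up e P.
Proof.
move=> he; rewrite /raise /momentum_low act12C act13C act1_comp mul_imetric //.
by rewrite act1_1 -act23C act3_comp act2_comp mul_imetric // act3_1 act2_1.
Qed.

Lemma torsion_trace_act13 {R : realType} (M : 'M[R]_4) t :
  torsion_trace (act1 M t) = torsion_trace (act3 M^T t).
Proof.
apply/funext => m; rewrite /torsion_trace /act1 /act3 exchange_big.
by apply: eq_bigr => s _; apply: eq_bigr => r _; rewrite mxE.
Qed.

Lemma torsion_trace_act2 {R : realType} (M : 'M[R]_4) t :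
  torsion_trace (act2 M t) = actv M (torsion_trace t).
Proof.
apply/funext => m; rewrite /torsion_trace /actv exchange_big.
by apply: eq_bigr => s _; rewrite mulr_sumr.
Qed.

Lemma momentum_trace_upE {R : realType} (e : 'M[R]_4) P :
  momentum_trace_up e P = torsion_trace (act1 e^T P).
Proof.
apply/funext => m; rewrite /momentum_trace_up exchange_big.
by apply: eq_bigr => n _; apply: eq_bigr => a _; rewrite mxE.
Qed.

(** Under the trace, the inverse metric on the first slot moves to the third and cancels the
    lowering there. Only the lowering of the free index remains. *)
Lemma momentum_traceE {R : realType} (e : 'M[R]_4) P : e \in unitmx ->
  momentum_trace e P = torsion_trace (act1 (imetric e) (momentum_low e P)).
Proof.
move=> he; rewrite momentum_lowE // torsion_trace_act13 imetric_tr.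
rewrite act12C act13C act23C act3_comp mul_imetric // act3_1.
by rewrite torsion_trace_act2 -momentum_trace_upE.
Qed.

Lemma antisym_momentum_low {R : realType} (e : 'M[R]_4) P : e \in unitmx ->
  antisym P -> antisym (momentum_low e P).
Proof.
by move=> he aP; rewrite momentum_lowE //; apply/antisym_act1/antisym_act23.
Qed.

(** The closed form with which [momentum], chosen through its derivative property, is later
    identified. The transpose appears because the inverse frame has its coordinate index as row. *)
Definition legendre {R : realType} (e : 'M[R]_4) (kappa : R) (T : tensor R) :
  tensor R :=
  fun a m n => - (2 * vol e / kappa ^+ 2) *
    act1 (invmx e)^T (superpotential e T) a m n.

Lemma antisym_superpotential {R : realType} (e : 'M[R]_4) T : e \in unitmx ->
  antisym T -> antisym (superpotential e T).
Proof.
move=> he aT; rewrite superpotentialE //.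
by apply/antisym_act23/antisym_sup_low; [exact: metric_tr|exact: antisym_act1].
Qed.

Lemma antisym_legendre {R : realType} (e : 'M[R]_4) kappa T : e \in unitmx ->
  antisym T -> antisym (legendre e kappa T).
Proof.
by move=> he aT; apply/antisym_scale/antisym_act1/antisym_superpotential.
Qed.

Lemma dot_scale {R : realType} a (t u : tensor R) :
  dot (fun r m n => a * t r m n) u = a * dot t u.
Proof.
rewrite -[RHS]addr0 -(mul0r (dot t u)) -dot_lin; congr (dot _ u).
by apply: tensorP => r m n; rewrite mul0r addr0.
Qed.

(** * The momentum as the derivative of the Lagrangian *)

Lemma of_frameK {R : realType} (e : 'M[R]_4) T : e \in unitmx ->
  of_frame e (to_frame e T) = T.
Proof. by move=> he; rewrite /of_frame act1_comp mulVmx // act1_1. Qed.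

Lemma is_diff_lagrangian_frame {R : realType} (e : 'M[R]_4) kappa T :
  e \in unitmx ->
  is_diff (flat (to_frame e T)) (lagrangian_frame e kappa)
    (fun Y => - (2 / kappa ^+ 2) * vol e *
       (torsion_form e T (of_frame e (unflat Y)) +
        torsion_form e (of_frame e (unflat Y)) T)).
Proof.
move=> he.
pose B X Y : R := - (2 / kappa ^+ 2) * vol e *
  torsion_form e (of_frame e (unflat X)) (of_frame e (unflat Y)).
have linE a X Y : of_frame e (unflat (a *: X + Y)) = fun r m n =>
    a * of_frame e (unflat X) r m n + of_frame e (unflat Y) r m n.
  apply: tensorP => r m n; rewrite /of_frame -act1_lin; congr act1.
  by apply: tensorP => r' m' n'; rewrite !unflatE !mxE.
have dB : is_diff (flat (to_frame e T)) (fun Y => B Y Y : R^o)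
    (fun Y => B (flat (to_frame e T)) Y + B Y (flat (to_frame e T))).
  apply: is_diff_quadratic_mx => a X Y Z; rewrite /B linE.
    by rewrite torsion_form_linl; ring.
  by rewrite torsion_form_linr; ring.
apply: is_diff_eq dB _ => //.
by apply/funext => Y; rewrite /B flatK of_frameK // -mulrDr.
Qed.

Lemma is_momentum_legendre {R : realType} (e : 'M[R]_4) kappa T :
  e \in unitmx -> antisym T -> is_momentum e kappa T (legendre e kappa T).
Proof.
move=> he aT; have dL := is_diff_lagrangian_frame e kappa T he.
split; [exact: antisym_legendre|exact: ex_diff|move=> dF adF].
(* The derivative is the symmetrized form at [T] and the variation, that is, a pairing with the
   superpotential. The inverse frame then moves from the variation to the superpotential as its
   transpose. *)
rewrite diff_val flatK torsion_form_sym //; last exact: antisym_act1.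
rewrite -[RHS]/(dot (legendre e kappa T) dF) dot_scale dot_act1 trmxK.
by rewrite /of_frame; ring.
Qed.

(** The difference [D] of two momenta is antisymmetric, hence an admissible variation. Testing both
    on it gives [dot D D = 0]. *)
Lemma is_momentum_unique {R : realType} (e : 'M[R]_4) kappa T P Q :
  is_momentum e kappa T P -> is_momentum e kappa T Q -> P = Q.
Proof.
move=> [aP _ dP] [aQ _ dQ].
pose D : tensor R := fun r m n => 1 * P r m n + -1 * Q r m n.
have aD : antisym D by move=> r m n; rewrite /D aP aQ; ring.
have D0 : dot D D = 0.
  by rewrite {1}/D dot_lin /dot -dP // -dQ // mul1r mulN1r subrr.
apply: tensorP => r m n; have := dot_self_eq0 _ D0 r m n.
by rewrite /D mul1r mulN1r => /eqP; rewrite subr_eq0 => /eqP.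
Qed.

Lemma momentumE {R : realType} (e : 'M[R]_4) kappa T :
  e \in unitmx -> antisym T -> momentum e kappa T = legendre e kappa T.
Proof.
move=> he aT; have h := is_momentum_legendre e kappa T he aT.
apply: (is_momentum_unique e kappa T _ _ _ h).
(* [legendre] inhabits the set of momenta, so [xget] does not fall back on its zero default. *)
exact: (@xgetPex _ (fun _ _ _ => 0) [set P | is_momentum e kappa T P]
  (ex_intro _ _ h)).
Qed.

(** * Inverting the Legendre map *)

Lemma act1_scale {R : realType} (M : 'M[R]_4) a t :
  act1 M (fun r m n => a * t r m n) = fun r m n => a * act1 M t r m n.
Proof.
apply: tensorP => r m n; rewrite /act1 mulr_sumr.
by apply: eq_bigr => s _; rewrite mulrCA.
Qed.

Lemma act2_scale {R : realType} (M : 'M[R]_4) a t :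
  act2 M (fun r m n => a * t r m n) = fun r m n => a * act2 M t r m n.
Proof.
apply: tensorP => r m n; rewrite /act2 mulr_sumr.
by apply: eq_bigr => s _; rewrite mulrCA.
Qed.

Lemma act3_scale {R : realType} (M : 'M[R]_4) a t :
  act3 M (fun r m n => a * t r m n) = fun r m n => a * act3 M t r m n.
Proof.
apply: tensorP => r m n; rewrite /act3 mulr_sumr.
by apply: eq_bigr => s _; rewrite mulrCA.
Qed.

(** Lowering undoes the two raisings in [superpotentialE], and the coframe undoes the inverse frame.
    In lowered indices the Legendre map is thus a scalar times [sup_low]. *)
Lemma momentum_low_legendre {R : realType} (e : 'M[R]_4) kappa T :
  e \in unitmx ->
  momentum_low e (legendre e kappa T) = fun r m n =>
    - (2 * vol e / kappa ^+ 2) *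
    sup_low (metric e) (imetric e) (torsion_low e T) r m n.
Proof.
move=> he; rewrite momentum_lowE // act3_scale act2_scale act1_scale.
rewrite superpotentialE // -act13C -act12C -act23C.
rewrite act3_comp act2_comp act1_comp.
rewrite mul_metric // act3_1 act2_1.
by rewrite -trmx_mul mulVmx // trmx1 act1_1.
Qed.

Lemma momentum_torsion_low {R : realType} (e : 'M[R]_4) kappa T :
  e \in unitmx -> 0 < kappa ^+ 2 -> antisym T ->
  forall r m n, torsion_low e T r m n = kappa ^+ 2 / (2 * vol e) *
    sup_low_inv (metric e) (imetric e)
      (momentum_low e (momentum e kappa T)) r m n.
Proof.
move=> he hk aT r m n.
rewrite momentumE // momentum_low_legendre // sup_low_inv_scale sup_lowK.
- by field; rewrite (vol_neq0 e he) (sqr_gt0_neq0 kappa hk).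
- exact: imetric_tr.
- exact: metric_tr.
- exact: mul_imetric.
- exact: antisym_act1.
Qed.

Lemma momentum_of_torsion_low {R : realType} (e : 'M[R]_4) kappa T P :
  e \in unitmx -> 0 < kappa ^+ 2 -> antisym T -> antisym P ->
  (forall r m n, torsion_low e T r m n = kappa ^+ 2 / (2 * vol e) *
     sup_low_inv (metric e) (imetric e) (momentum_low e P) r m n) ->
  momentum e kappa T = P.
Proof.
move=> he hk aT aP tE; rewrite momentumE //.
(* Lowering the indices of a momentum is invertible, so it suffices to compare the lowered forms. *)
rewrite -[LHS](momentum_lowK e) // -[RHS](momentum_lowK e) //.
congr (act1 _ (act2 _ (act3 _ _))).
rewrite momentum_low_legendre // (tensorP _ _ tE).
apply: tensorP => r m n; rewrite sup_low_scale sup_low_invK.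
- by field; rewrite (vol_neq0 e he) (sqr_gt0_neq0 kappa hk).
- exact: imetric_tr.
- exact: metric_tr.
- exact: mul_imetric.
- exact: antisym_momentum_low.
Qed.

Lemma torsion_lowK {R : realType} (e : 'M[R]_4) T : e \in unitmx ->
  act1 (imetric e) (torsion_low e T) = T.
Proof. by move=> he; rewrite /torsion_low act1_comp mul_imetric // act1_1. Qed.

Lemma momentum_bij {R : realType} (e : 'M[R]_4) kappa :
  e \in unitmx -> 0 < kappa ^+ 2 ->
  set_bij (@antisym R) (@antisym R) (momentum e kappa).
Proof.
move=> he hk; split.
- by move=> T aT; rewrite momentumE //; exact: antisym_legendre.
- move=> T U; rewrite !inE => aT aU TU.
  have tu : torsion_low e T = torsion_low e U.
    apply: tensorP => r m n.
    rewrite (momentum_torsion_low e kappa T he hk aT) TU.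
    by rewrite -(momentum_torsion_low e kappa U he hk aU).
  by rewrite -(torsion_lowK e T he) tu (torsion_lowK e U he).
(* The preimage is the inverse formula with its first index raised, since torsions are stored in
   mixed form. *)
- move=> P aP; pose t : tensor R := fun r m n => kappa ^+ 2 / (2 * vol e) *
    sup_low_inv (metric e) (imetric e) (momentum_low e P) r m n.
  have at_ : antisym (act1 (imetric e) t).
    exact/antisym_act1/antisym_scale/antisym_sup_low_inv.
  exists (act1 (imetric e) t) => //.
  apply: momentum_of_torsion_low => // r m n.
  by rewrite /torsion_low act1_comp mul_metric // act1_1.
Qed.

(** * The Hamiltonian in terms of the momenta *)

Lemma torsion_momentum_pairing {R : realType} (e : 'M[R]_4) kappa T :
  e \in unitmx -> antisym T ->
  dot (to_frame e T) (momentum e kappa T) = 2 * lagrangian e kappa T.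
Proof.
move=> he aT; rewrite momentumE // dotC dot_scale dot_act1 trmxK.
(* With both arguments equal to [T], the symmetrized form is twice the torsion scalar; this is
   Euler's identity in degree 2. *)
rewrite -/(of_frame e (to_frame e T)) of_frameK // -torsion_form_sym //.
by rewrite /lagrangian torsion_scalarE; ring.
Qed.

(** The terms without trace are minus the two cyclic shifts of [p], whose pairings with [raise h p]
    coincide, hence the -2. The two trace terms are exchanged by swapping the last slots, so they
    contribute equally, each with weight -1/2. *)
Lemma dot_sup_low_inv {R : realType} (g h : 'M[R]_4) p :
  h^T = h -> g^T = g -> h *m g = 1%:M -> antisym p ->
  dot (sup_low_inv g h p) (raise h p) =
  - 2 * dot (raise h p) (cyc p)
  - \sum_m torsion_trace (act1 h p) m * actv h (torsion_trace (act1 h p)) m.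
Proof.
move=> hT gT hg ap; set pi := torsion_trace (act1 h p).
have gC i j : g i j = g j i by rewrite -{1}gT mxE.
have gh : g *m h = 1%:M by rewrite -[g]gT -[h]hT -trmx_mul hg trmx1.
have arp : antisym (raise h p) by exact/antisym_act1/antisym_act23.
pose G : tensor R := fun r m n => pi m * g n r.
have -> : sup_low_inv g h p = fun r m n => 1 *
   (fun r m n => -1 * cyc p r m n + -1 * cyc (cyc p) r m n) r m n + 1 *
   (fun r m n => 2^-1 * (fun r m n => G r n m) r m n + - 2^-1 * G r m n) r m n.
  apply: tensorP => r m n; rewrite /sup_low_inv /cyc /G -/pi.
  by rewrite (ap m r n) (gC r m) (gC r n); ring.
rewrite !dot_lin (dot_antisym G) //.
have -> : dot (cyc (cyc p)) (raise h p) = dot (cyc p) (raise h p).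
  by rewrite -dot_raise // -dot_cyc -2!cyc_raise dotC.
(* The metric in [G] is split off as a lowering of the third slot. Moved to the other factor, it
   cancels one raising and leaves a plain trace. *)
have -> : G = act3 g (fun r m n => pi m * (n == r)%:R).
  apply: tensorP => r m n; rewrite /act3 (bigD1 r) //= eqxx mulr1.
  rewrite big1 ?addr0 1?mulrC // => s /negPf sr.
  by rewrite sr !mulr0.
rewrite dot_act3 gT.
have -> : act3 g (raise h p) = act2 h (act1 h p).
  by rewrite /raise -act13C -act23C act3_comp gh act3_1 act12C.
rewrite dot_trace torsion_trace_act2 -/pi [dot (raise h p) _]dotC.
by field.
Qed.

Lemma actv_imetric_momentum_trace {R : realType} (e : 'M[R]_4) P :
  e \in unitmx ->
  actv (imetric e) (momentum_trace e P) = momentum_trace_up e P.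
Proof.
move=> he; rewrite /momentum_trace momentum_trace_upE -!torsion_trace_act2.
by rewrite act2_comp mul_imetric // act2_1.
Qed.

(** A full contraction does not depend on whether the first index is a frame index or a coordinate
    index, nor on which factor carries the lowered ones. *)
Lemma dot_to_frame {R : realType} (e : 'M[R]_4) T P : e \in unitmx ->
  dot (to_frame e T) P = dot (torsion_low e T) (momentum_up e P).
Proof.
move=> he; rewrite -raise_momentum_low // momentum_lowE // /raise.
rewrite -[act3 _ (act1 _ _)]act13C -[act2 _ (act1 _ _)]act12C.
rewrite -[act3 _ (act2 _ _)]act23C.
rewrite act3_comp act2_comp mul_imetric // act3_1 act2_1.
rewrite -[in LHS](torsion_lowK e T) // /to_frame !dot_act1.
by rewrite imetric_tr.
Qed.

Theorem mainTheorem4 (R : realType) (e : 'M[R]_4) (kappa : R)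
  (he : e \in unitmx) (hkappa : 0 < kappa ^+ 2) :
  [/\ (exists2 V : {vspace 'M[R]_(4, 4 * 4)},
         (forall X : 'M[R]_(4, 4 * 4), X \in V <-> antisym (unflat X))
         & \dim V = 24%N),
      (forall T : tensor R, antisym T ->
         is_momentum e kappa T (momentum e kappa T) /\
         forall a mu nu,
           momentum e kappa T a mu nu =
           - (2 * vol e / kappa ^+ 2) *
             (\sum_rho invmx e rho a * superpotential e T rho mu nu)),
      set_bij (@antisym R) (@antisym R) (momentum e kappa),
      (forall T P : tensor R, antisym T -> antisym P ->
         (momentum e kappa T = P <->
          forall rho mu nu,
            torsion_low e T rho mu nu =
            kappa ^+ 2 / (2 * vol e) *
              (momentum_low e P mu rho nu - momentum_low e P nu rho mu
               + 2^-1 * (metric e rho mu * momentum_trace e P nu)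
               - 2^-1 * (metric e rho nu * momentum_trace e P mu))))
    & (forall T P : tensor R, antisym T -> P = momentum e kappa T ->
         hamiltonian e kappa T P =
         - (kappa ^+ 2 / (2 * vol e)) *
           ((\sum_rho \sum_mu \sum_nu
               momentum_up e P rho mu nu * momentum_low e P mu nu rho)
            + 2^-1 * (\sum_mu momentum_trace_up e P mu
                                * momentum_trace e P mu)))].
Proof.
split.
- exact: antisym_vspace.
- move=> T aT; rewrite momentumE //; split; first exact: is_momentum_legendre.
  move=> a mu nu; congr (_ * _); apply: eq_bigr => rho _.
  by rewrite mxE.
- exact: momentum_bij.
- have invE P rho mu nu :
      momentum_low e P mu rho nu - momentum_low e P nu rho mu
      + 2^-1 * (metric e rho mu * momentum_trace e P nu)
      - 2^-1 * (metric e rho nu * momentum_trace e P mu) =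
      sup_low_inv (metric e) (imetric e) (momentum_low e P) rho mu nu.
    by rewrite momentum_traceE.
  move=> T P aT aP; split=> [<- rho mu nu|tE].
    by rewrite invE; exact: momentum_torsion_low.
  by apply: momentum_of_torsion_low => // rho mu nu; rewrite -invE.
- move=> T P aT PE.
  have aP : antisym P by rewrite PE momentumE //; exact: antisym_legendre.
  have tE : torsion_low e T = fun r m n => kappa ^+ 2 / (2 * vol e) *
      sup_low_inv (metric e) (imetric e) (momentum_low e P) r m n.
    by apply: tensorP => r m n; rewrite PE; exact: momentum_torsion_low.
  have LE : 2 * lagrangian e kappa T = dot (torsion_low e T) (momentum_up e P).
    by rewrite -torsion_momentum_pairing // -PE dot_to_frame.
  have -> : hamiltonian e kappa T P =
      2^-1 * dot (torsion_low e T) (momentum_up e P).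
    rewrite /hamiltonian -/(dot (to_frame e T) P) PE.
    rewrite torsion_momentum_pairing //.
    by rewrite -PE -LE; field.
  (* Half of the pairing, with the -2 and -1 of [dot_sup_low_inv], produces the overall minus sign
     and the weight 1/2 of the trace term. *)
  rewrite tE dot_scale -raise_momentum_low // dot_sup_low_inv.
  + rewrite -momentum_traceE // actv_imetric_momentum_trace //.
    rewrite raise_momentum_low //.
    under eq_bigr do rewrite mulrC.
    rewrite -/(dot (momentum_up e P) (cyc (momentum_low e P))).
    by field; rewrite (vol_neq0 e he).
  + exact: imetric_tr.
  + exact: metric_tr.
  + exact: mul_imetric.
  + exact: antisym_momentum_low.
Qed.
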